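(* Let $m\ge 2$ be an integer. There is a function $\delta'=\delta'(\delta,m)$ of $\delta>0$, depending only on $\delta$ and $m$, with $\delta'(\delta,m)\to 0$ as $\delta\to 0^+$, such that the following holds for every $\delta>0$. Let $G$ be a finite group (not necessarily abelian, written multiplicatively) of order $N$, let $A_1,\ldots,A_m$ be subsets of $G$, and let $g$ be an arbitrary element of $G$. If the equation $x_1x_2\cdots x_m=g$ has less than $\delta N^{m-1}$ solutions $(x_1,\ldots,x_m)$ with $x_i\in A_i$ for all $i$, then there are subsets $A'_i\subseteq A_i$ with $|A_i\setminus A'_i|\le \delta' N$ for all $i=1,\ldots,m$ such that there is no solution of the equation $x_1x_2\cdots x_m=g$ with $x_i\in A'_i$ for all $i$.
   Context: The function $\delta'$ does not depend on the order $N$ of the group $G$, on its structure, on the sets $A_i$, or on $g$. This is the precise meaning of the asymptotic formulation: ''if the equation has $o(N^{m-1})$ solutions with $x_i\in A_i$, then there are subsets $A_i'\subseteq A_i$ with $|A_i\setminus A_i'|=o(N)$ such that there is no solution with $x_i\in A_i'$''. *)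

(* Defs.v *)
From HB Require Import structures.
From mathcomp Require Import all_boot all_order all_algebra all_fingroup.

Set Implicit Arguments.
Unset Strict Implicit.
Unset Printing Implicit Defensive.

(* The group product over 'I_m is taken in increasing order of the index, so
   the equation below is x_1 x_2 ... x_m = g; commutativity is not assumed. *)
Definition solutions (gT : finGroupType) (m : nat) (A : 'I_m -> {set gT})
    (g : gT) : {set {ffun 'I_m -> gT}} :=
  [set x : {ffun 'I_m -> gT} |
    [forall i, x i \in A i] && ((\prod_(i < m) x i)%g == g)].

(* Main.v *)
Require Import Defs.
From mathcomp Require Import all_boot all_order all_algebra all_fingroup.
From mathcomp Require Import ring lra.
Set Implicit Arguments.
Unset Strict Implicit.
Unset Printing Implicit Defensive.
Import Order.TTheory GRing.Theory Num.Theory.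
Local Open Scope ring_scope.

(** The removal statement is deduced from a removal lemma for closed walks in
dense directed graphs, by way of Cayley graphs.

From groups to walks. After the last set is multiplied by the inverse of [g],
the equation reads [x_1 ... x_m = 1]. Join [u] to [v] by an edge of kind [i]
when [u^-1 v] lies in [A_i]. A closed walk with one edge of each kind, in order,
is a starting vertex together with a solution, so there are [N] times as many
closed walks as solutions, and few solutions give few closed walks: fewer than
[delta * N ^ m]. The removal lemma [closed_walk_removal] then destroys all of
them by deleting a set [D] of at most [eps * N ^ 2] edges. Delete [x] from
[A_i] when at least [N / m] of the [N] edges of kind [i] labelled [x] are in
[D]; only few [x] are lost. A solution that survived would give [N]
edge-disjoint closed walks, one from each vertex, all of which meet [D]: so one
of its [m] labels would have [N / m] edges in [D], a contradiction. The case
[m = 2] needs no graphs, because there a solution is determined by its first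
entry and one can delete every element that occurs in a solution.

Removing walks. Colour the vertices with boundedly many colours so that, for
each kind of edge, almost all pairs of vertices lie in a pair of colour classes
that is either sparse or lower-regular: no two large subsets of the
classes span an unexpectedly small number of edges ([regularity]). Such a
colouring is found by energy increment: the energy is the mean square of the
edge densities seen through the colouring; splitting all classes along
the subsets that witness irregularity raises it by a fixed amount
([energy_increment_irregular]), and it is bounded ([total_energy_le]). Delete
the edges in irregular pairs, in sparse pairs, and at tiny classes. If a closed
walk survives, the classes that it visits are large and consecutive ones are
dense and lower-regular, and a greedy count yields a positive proportion of
all closed sequences of vertices ([closed_walks_lower_bound]), contradicting
that closed walks are few.

From [eps] to a function of [delta]. For each [delta] let [delta'] be the
infimum of the admissible [eps], plus [delta]. The added [delta] makes sure
that [delta'] exceeds some admissible value, and it tends to [0] with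
[delta]. *)

(** * Averages over the classes of a colouring *)

Section CellAverages.
Variables (R : realFieldType) (S : finType) (f : S -> R).

Definition cell_avg (L : finType) (C : S -> L) (l : L) : R :=
  (\sum_(s | C s == l) f s) / #|[pred s | C s == l]|%:R.

Definition energy (L : finType) (C : S -> L) : R :=
  \sum_s cell_avg C (C s) ^+ 2.

(** [s |-> cell_avg C (C s)] is the conditional expectation of [f] given [C]:
pairing it with a function of the colour is the same as pairing [f] itself. *)
Lemma sum_cell_avg_mul (L : finType) (C : S -> L) (h : L -> R) :
  \sum_s cell_avg C (C s) * h (C s) = \sum_s f s * h (C s).
Proof.
rewrite (partition_big C xpredT) //= [RHS](partition_big C xpredT) //=.
apply: eq_bigr => l _.
under eq_bigr => s /eqP-> do [].
under [RHS]eq_bigr => s /eqP-> do [].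
rewrite sumr_const -mulr_suml -mulr_natl mulrA; congr (_ * _).
have [c0|c0] := eqVneq #|[pred s | C s == l]| 0%N.
  rewrite (eq_card (B := [pred s | C s == l])) // c0 mul0r big1 // => s sl.
  by have := card0_eq c0 s; rewrite !inE sl.
by rewrite mulrC divfK // pnatr_eq0.
Qed.

(** Pythagoras: the conditional expectation given [C] is the orthogonal
projection of the one given the finer [C']. *)
Lemma energy_refine (L L' : finType) (C : S -> L) (C' : S -> L') (p : L' -> L) :
  (forall s, p (C' s) = C s) ->
  energy C' = energy C +
    \sum_s (cell_avg C (C s) - cell_avg C' (C' s)) ^+ 2.
Proof.
move=> pC.
have cross : \sum_s cell_avg C' (C' s) * cell_avg C (C s) = energy C.
  under eq_bigr => s _ do rewrite -pC.
  rewrite (sum_cell_avg_mul C' (fun l => cell_avg C (p l))).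
  under eq_bigr => s _ do rewrite pC.
  by rewrite -sum_cell_avg_mul; apply: eq_bigr => s _; rewrite expr2.
rewrite (eq_bigr (fun s => cell_avg C (C s) ^+ 2 + cell_avg C' (C' s) ^+ 2
   - 2 * (cell_avg C' (C' s) * cell_avg C (C s)))); last by move=> s _; ring.
rewrite sumrB big_split /= -mulr_sumr cross -/(energy C) -/(energy C'); ring.
Qed.

(** Suppose that every bad cell of [C] has density at least [2 a], but contains
a union of cells of [C'], of relative size at least [b], where the density is at
most [a]. On those parts the two conditional expectations differ by [a] on
average, which by convexity bounds their squared distance from below. *)
Lemma energy_increment (L L' : finType) (C : S -> L) (C' : S -> L') (p : L' -> L)
    (a b : R) (bad : pred L) (z : pred L') :
  0 <= a -> (forall s, p (C' s) = C s) ->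
  (forall l, bad l -> [/\ 2 * a <= cell_avg C l,
     \sum_(s | (C s == l) && z (C' s)) f s
       <= a * #|[pred s | (C s == l) && z (C' s)]|%:R &
     b * #|[pred s | C s == l]|%:R <= #|[pred s | (C s == l) && z (C' s)]|%:R]) ->
  energy C + a ^+ 2 * b * #|[pred s | bad (C s)]|%:R <= energy C'.
Proof.
move=> a0 pC badP; rewrite (energy_refine pC) lerD2l.
pose w s := bad (C s) && z (C' s).
pose u s := cell_avg C (C s) - cell_avg C' (C' s).
have sum_f : \sum_(s | w s) f s <= \sum_(s | w s) a.
  rewrite (partition_big C bad) /=; last by move=> s /andP[].
  rewrite [leRHS](partition_big C bad) /=; last by move=> s /andP[].
  apply: ler_sum => l bl; have [_ fl _] := badP l bl.
  have wE s : (w s && (C s == l)) = (C s == l) && z (C' s).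
    by rewrite /w; case: eqP => [->|]; rewrite ?bl ?andbT ?andbF.
  by rewrite !(eq_bigl _ _ wE) sumr_const -mulr_natr.
have card_w : b * #|[pred s | bad (C s)]|%:R <= #|w|%:R.
  rewrite -!sum1_card !natr_sum (partition_big C bad) //=.
  rewrite [leRHS](partition_big C bad) /=; last by move=> s /andP[].
  rewrite mulr_sumr; apply: ler_sum => l bl; have [_ _ cl] := badP l bl.
  have wE s : (w s && (C s == l)) = (C s == l) && z (C' s).
    by rewrite /w; case: eqP => [->|]; rewrite ?bl ?andbT ?andbF.
  have bE s : (bad (C s) && (C s == l)) = (C s == l).
    by case: eqP => [->|]; rewrite ?bl ?andbT ?andbF.
  move: cl; rewrite (eq_bigl _ _ wE) (eq_bigl _ _ bE) -!natr_sum !sum1_card.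
  by [].
have sum_u : \sum_(s | w s) a <= \sum_(s | w s) u s.
  rewrite sumrB.
  have -> : \sum_(s | w s) cell_avg C' (C' s) = \sum_(s | w s) f s.
    pose h l := (bad (p l) && z l)%:R : R.
    have hE (F : S -> R) : \sum_(s | w s) F s = \sum_s F s * h (C' s).
      rewrite big_mkcond; apply: eq_bigr => s _; rewrite /h pC -/(w s).
      by case: (w s); rewrite ?mulr1 ?mulr0.
    by rewrite !hE sum_cell_avg_mul.
  have : \sum_(s | w s) (2 * a) <= \sum_(s | w s) cell_avg C (C s).
    by apply: ler_sum => s /andP[/badP[]].
  by rewrite -mulr_sumr; lra.
(* The tangent line u ^ 2 >= 2 a u - a ^ 2 replaces the Cauchy-Schwarz inequality. *)
apply: (@le_trans _ _ (\sum_(s | w s) u s ^+ 2)); last first.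
  by rewrite [leRHS](bigID w) /= lerDl sumr_ge0 // => s _; rewrite sqr_ge0.
apply: (@le_trans _ _ (\sum_(s | w s) (2 * a * u s - a * a))); last first.
  by apply: ler_sum => s _; have := sqr_ge0 (u s - a); lra.
rewrite sumrB -!mulr_sumr.
have : a * \sum_(s | w s) a <= a * \sum_(s | w s) u s by rewrite ler_wpM2l.
rewrite sumr_const -mulr_natr expr2.
by move: (ler_wpM2l (mulr_ge0 a0 a0) card_w); lra.
Qed.

End CellAverages.

(** * Lower-regular colourings *)

Section Regularity.
Variable R : archiRealFieldType.

Section Pairs.
Variable T : finType.
Implicit Types (E : rel T) (P Q X Y : {set T}).

Definition edges E X Y : nat := (\sum_(x in X) \sum_(y in Y) E x y)%N.

(** A witness of irregularity. The cut-off [2 * eps] is half of the density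
[4 * eps] from which on a pair counts as [dense]; only a lack of edges matters
for counting walks, so an excess is not regarded as irregular. *)
Definition hole (eps : R) E P Q (Z : {set T} * {set T}) : bool :=
  [&& Z.1 \subset P, Z.2 \subset Q,
      eps * #|P|%:R <= #|Z.1|%:R, eps * #|Q|%:R <= #|Z.2|%:R &
      (edges E Z.1 Z.2)%:R < 2 * eps * (#|Z.1| * #|Z.2|)%:R].

Definition lower_regular eps E P Q : bool := [forall Z, ~~ hole eps E P Q Z].

Definition dense (eps : R) E P Q : bool :=
  4 * eps * (#|P| * #|Q|)%:R <= (edges E P Q)%:R.

(** Sparse pairs are never bad: their edges can simply be deleted. *)
Definition bad eps E P Q : bool :=
  dense eps E P Q && ~~ lower_regular eps E P Q.

Lemma sum_rect (V : nmodType) (X Y : {set T}) (F : T * T -> V) :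
  \sum_(s | (s.1 \in X) && (s.2 \in Y)) F s
    = \sum_(x in X) \sum_(y in Y) F (x, y).
Proof. by rewrite pair_big /=; apply: eq_bigr => -[]. Qed.

Lemma card_rect (X Y : {set T}) :
  #|[pred s : T * T | (s.1 \in X) && (s.2 \in Y)]| = (#|X| * #|Y|)%N.
Proof.
rewrite -cardsX -[LHS]cardsE; apply: eq_card => s.
by rewrite !inE.
Qed.

Lemma sum_edges E X Y :
  \sum_(s | (s.1 \in X) && (s.2 \in Y)) (E s.1 s.2)%:R = (edges E X Y)%:R :> R.
Proof. by rewrite sum_rect natr_sum; apply: eq_bigr => x _; rewrite natr_sum. Qed.

Variables (K : finType) (c : T -> K).

Definition part a : {set T} := [set x | c x == a].

Definition pair_color (s : T * T) : K * K := (c s.1, c s.2).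

Lemma pair_colorE ab s :
  (pair_color s == ab) = (s.1 \in part ab.1) && (s.2 \in part ab.2).
Proof. by case: ab => a b; rewrite !inE xpair_eqE. Qed.

End Pairs.

Definition regular_coloring (eps eta : R) (I T K : finType) (E : I -> rel T)
    (c : T -> K) : bool :=
  (\sum_i #|[pred s : T * T | bad eps (E i) (part c (c s.1)) (part c (c s.2))]|)%:R
    <= eta * #|T|%:R ^+ 2.

Definition total_energy (I T K : finType) (E : I -> rel T) (c : T -> K) : R :=
  \sum_i energy (fun s => (E i s.1 s.2)%:R) (pair_color c).

(** The number of colours after one refinement: the new colour of [x] consists of
its old one and two sets of triples (relation, colour, colour), which record in
which left and right sides of witnesses [x] lies. *)
Definition color_blowup (i k : nat) : nat := (k * (2 ^ (i * k ^ 2)) ^ 2)%N.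

(** Refining the colouring along one witness for each bad pair of classes
gains [(2 * eps) ^ 2] on at least a proportion [eps ^ 2] of each bad pair. *)
Lemma energy_increment_irregular (eps eta : R) (I T K : finType) (E : I -> rel T)
    (c : T -> K) :
  0 < eps -> ~~ regular_coloring eps eta E c ->
  exists (K' : finType) (c' : T -> K'),
    #|K'| = color_blowup #|I| #|K| /\
    total_energy E c + (2 * eps) ^+ 2 * eps ^+ 2 * (eta * #|T|%:R ^+ 2)
      <= total_energy E c'.
Proof.
move=> e0; rewrite /regular_coloring -ltNge => irr.
pose W i (ab : K * K) :=
  odflt (finset.set0, finset.set0) [pick Z | hole eps (E i) (part c ab.1) (part c ab.2) Z].
pose label := {set I * (K * K)}.
pose near1 x : label := [set l | (c x == l.2.1) && (x \in (W l.1 l.2).1)].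
pose near2 x : label := [set l | (c x == l.2.2) && (x \in (W l.1 l.2).2)].
pose c' x := (c x, (near1 x, near2 x)).
exists (K * (label * label))%type, c'; split.
  rewrite !card_prod /label -!cardsT -!powersetT !card_powerset !cardsT !card_prod.
  by rewrite /color_blowup !mulnn.
apply: (@le_trans _ _ (total_energy E c + \sum_i (2 * eps) ^+ 2 * eps ^+ 2 *
  #|[pred s : T * T | bad eps (E i) (part c (c s.1)) (part c (c s.2))]|%:R)).
  rewrite lerD2l -mulr_sumr -natr_sum ler_wpM2l ?(ltW irr) //.
  exact: mulr_ge0 (sqr_ge0 _) (sqr_ge0 _).
rewrite /total_energy -big_split /=; apply: ler_sum => i _.
pose p (l : (K * (label * label)) * (K * (label * label))) := (l.1.1, l.2.1).
pose z l := ((i, p l) \in l.1.2.1) && ((i, p l) \in l.2.2.2).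
apply: (@energy_increment _ _ _ _ _ (pair_color c) (pair_color c') p
  (2 * eps) (eps ^+ 2) (fun ab => bad eps (E i) (part c ab.1) (part c ab.2)) z).
- by rewrite mulr_ge0 // ltW.
- by case.
move=> [a b] /= /andP[dn]; rewrite /lower_regular negb_forall => /existsP[Z0].
rewrite negbK => holeZ0.
have : hole eps (E i) (part c a) (part c b) (W i (a, b)).
  by rewrite /W; case: pickP => [//|/(_ Z0)]; rewrite holeZ0.
case WE: (W i (a, b)) => [X Y] /and5P[/= XP YQ cX cY eXY].
have zE s : (pair_color c s == (a, b)) && z (pair_color c' s)
    = (s.1 \in X) && (s.2 \in Y).
  rewrite pair_colorE /= !inE /=.
  case: eqP => [c1|n1] /=; last first.
    by case: (boolP (s.1 \in X)) => //= /(subsetP XP); rewrite inE => /eqP.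
  case: eqP => [c2|n2] /=; last first.
    rewrite andbC; case: (boolP (s.2 \in Y)) => //= /(subsetP YQ).
    by rewrite inE => /eqP.
  by rewrite /z /p /= !inE /= !eqxx c1 c2 WE.
have cardC : #|[pred s | pair_color c s == (a, b)]| = (#|part c a| * #|part c b|)%N.
  by rewrite -card_rect; apply: eq_card => s; rewrite !inE pair_colorE !inE.
split.
- rewrite /cell_avg cardC (eq_bigl _ _ (pair_colorE c (a, b))) sum_edges.
  (* Empty classes are dense by convention, but they admit no witness. *)
  have [XY0|XY0] := eqVneq (#|X| * #|Y|)%N 0%N.
    by move: eXY; rewrite XY0 mulr0 ltrn0.
  rewrite ler_pdivlMr.
    by move: dn; rewrite /dense; lra.
  rewrite ltr0n; apply: leq_trans (leq_mul (subset_leq_card XP) (subset_leq_card YQ)).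
  by rewrite lt0n.
- rewrite (eq_bigl _ _ zE) sum_edges (eq_card (B := [pred s : T * T | (s.1 \in X) && (s.2 \in Y)])).
    by rewrite card_rect ltW.
  by move=> s; rewrite !inE zE.
- rewrite cardC (eq_card (B := [pred s : T * T | (s.1 \in X) && (s.2 \in Y)])).
    rewrite card_rect !natrM expr2 mulrACA ler_pM // mulr_ge0 //; exact: ltW.
  by move=> s; rewrite !inE zE.
Qed.

Lemma total_energy_ge0 (I T K : finType) (E : I -> rel T) (c : T -> K) :
  0 <= total_energy E c.
Proof. by apply: sumr_ge0 => i _; apply: sumr_ge0 => s _; apply: sqr_ge0. Qed.

Lemma total_energy_le (I T K : finType) (E : I -> rel T) (c : T -> K) :
  total_energy E c <= #|I|%:R * #|T|%:R ^+ 2.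
Proof.
rewrite mulr_natl -sumr_const; apply: ler_sum => i _.
rewrite -natrX -mulnn -card_prod -[leRHS]sumr_const /energy.
apply: ler_sum => s _; rewrite expr_le1 //.
- rewrite /cell_avg ler_pdivrMr ?mul1r.
    by rewrite -sum1_card natr_sum ler_sum // => t _; case: E.
  by rewrite ltr0n; apply/card_gt0P; exists s; rewrite inE.
- by rewrite divr_ge0 ?ler0n // sumr_ge0.
Qed.

Lemma color_blowup_mono i : {homo color_blowup i : k l / (k <= l)%N}.
Proof.
move=> k l kl; rewrite leq_mul // leq_exp2r // leq_pexp2l // leq_mul2l.
by rewrite leq_exp2r // kl orbT.
Qed.

(** The induction is on the number [n] of increments that the energy can still
undergo before it exceeds its upper bound. *)
Lemma regularity_iter (eps eta : R) (I : finType) (n k : nat) :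
  0 < eps -> 0 < eta -> exists M : nat,
  forall (T K : finType) (E : I -> rel T) (c : T -> K),
  (0 < #|T|)%N -> (#|K| <= k)%N ->
  (#|I|%:R - n%:R * ((2 * eps) ^+ 2 * eps ^+ 2 * eta)) * #|T|%:R ^+ 2
    <= total_energy E c ->
  exists (K' : finType) (c' : T -> K'),
    (#|K'| <= M)%N /\ regular_coloring eps eta E c'.
Proof.
move=> e0 h0; set kappa := _ * eta.
have kappa0 : 0 < kappa by rewrite !mulr_gt0 ?exprn_gt0 ?mulr_gt0.
elim: n k => [|n IH] k.
  exists k => T K E c T0 Kk en.
  exists K, c; split=> //; apply/negPn/negP => irr.
  have [K' [c' [_]]] := energy_increment_irregular e0 irr.
  rewrite mulrA -/kappa => inc.
  have := total_energy_le E c'.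
  have : 0 < kappa * #|T|%:R ^+ 2 by rewrite mulr_gt0 // exprn_gt0 // ltr0n.
  move: en inc; rewrite mul0r subr0; lra.
have [M MP] := IH (color_blowup #|I| k).
exists (maxn k M) => T K E c T0 Kk en.
have [reg|irr] := boolP (regular_coloring eps eta E c).
  by exists K, c; rewrite leq_max Kk.
have [K' [c' [cK' inc]]] := energy_increment_irregular e0 irr.
have [||K2 [c2 [cK2 reg2]]] := MP T K' E c' T0.
- by rewrite cK' color_blowup_mono.
- move: inc en; rewrite mulrA -/kappa -natr1; lra.
by exists K2, c2; rewrite leq_max cK2 orbT.
Qed.

(** A lower-regular version of Szemeredi's regularity lemma, for a finite family
of relations at once; [M] is uniform in the vertex set and the relations. *)
Lemma regularity (eps eta : R) (I : finType) :
  0 < eps -> 0 < eta -> exists M : nat,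
  forall (T : finType) (E : I -> rel T), (0 < #|T|)%N ->
  exists (K : finType) (c : T -> K),
    (#|K| <= M)%N /\ regular_coloring eps eta E c.
Proof.
move=> e0 h0; pose kappa := (2 * eps) ^+ 2 * eps ^+ 2 * eta.
have kappa0 : 0 < kappa by rewrite !mulr_gt0 ?exprn_gt0 ?mulr_gt0.
pose n := Num.bound (#|I|%:R / kappa).
have [M MP] := regularity_iter I n 1 e0 h0.
exists M => T E T0; apply: (MP T unit E (fun=> tt)) => //.
  by rewrite card_unit.
apply: le_trans (total_energy_ge0 _ _).
rewrite -/kappa mulr_le0_ge0 ?exprn_ge0 ?ler0n // subr_le0.
rewrite -ler_pdivrMr // ltW // archi_boundP //.
by rewrite divr_ge0 ?ler0n // ltW.
Qed.

(** * Counting closed walks *)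

Section ClosedWalks.
Variable T : finType.

(** The number of walks from [u] to [v] whose successive edges belong to
[E 0], ..., [E j.-1]. *)
Fixpoint walks (E : nat -> rel T) (j : nat) (u v : T) : nat :=
  if j is i.+1 then (\sum_w walks E i u w * E i w v)%N else (u == v).

Lemma lower_regular_swap (eps : R) (E : rel T) (P Q : {set T}) :
  lower_regular eps E P Q -> lower_regular eps (fun y x => E x y) Q P.
Proof.
move=> /forallP reg; apply/forallP => -[Y X].
move: (reg (X, Y)); rewrite /hole /= /edges exchange_big /= (mulnC #|Y|).
apply: contra; case/and5P=> -> -> -> -> /=.
by [].
Qed.

(** The atypical vertices, together with [X], would be a witness against
lower-regularity if they were numerous. *)
Lemma few_atypical (eps : R) (E : rel T) (P Q X : {set T}) :
  0 < eps -> lower_regular eps E P Q -> (0 < #|Q|)%N -> X \subset P ->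
  eps * #|P|%:R <= #|X|%:R ->
  #|[set y in Q | (\sum_(x in X) E x y)%N%:R < 2 * eps * #|X|%:R]|%:R
    < eps * #|Q|%:R.
Proof.
move=> e0 /forallP reg Q0 XP cX; set Y := finset _; rewrite ltNge; apply/negP => cY.
have YQ : Y \subset Q by apply/subsetP => y; rewrite inE => /andP[].
move: (reg (X, Y)); rewrite /hole XP YQ cX cY /= => /negP; apply.
have -> : 2 * eps * (#|X| * #|Y|)%:R = \sum_(y in Y) (2 * eps * #|X|%:R).
  by rewrite sumr_const natrM -[RHS]mulr_natr mulrA.
rewrite /edges exchange_big /= natr_sum.
apply: ltr_sum; last by move=> y; rewrite inE => /andP[].
apply/hasP; have /card_gt0P[y Yy] : (0 < #|Y|)%N.
  by rewrite -(ltr0n R); apply: lt_le_trans cY; rewrite mulr_gt0 // ltr0n.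
by exists y => //; rewrite mem_index_enum.
Qed.

(** Start from a vertex [u] of [P 0] that has many out-neighbours in [P 1] and
many in-neighbours in the last class; most vertices are such. The vertices of
[P j] that are reached from [u] by many walks form a large subset: for [j = 1] by
the choice of [u], and then because almost every vertex of the next class has
many neighbours in the subset. In the last class the subset misses so few
vertices that it meets the in-neighbourhood of [u] in a large set, which closes
the walks. Having at least three classes separates the out-neighbourhood from
the in-neighbourhood of [u]: the last class is not the first one reached. *)
Lemma closed_walks_lower_bound (eps gam : R) (n : nat) (E : nat -> rel T)
    (P : nat -> {set T}) :
  0 < eps -> eps <= 4^-1 -> 0 < gam -> (0 < #|T|)%N -> P n.+3 = P 0%N ->
  (forall i, (i < n.+3)%N -> lower_regular eps (E i) (P i) (P i.+1)) ->
  (forall i, (i < n.+3)%N -> gam * #|T|%:R <= #|P i|%:R) ->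
  gam / 2 * (eps * gam) * (2 * eps * (eps * gam)) ^+ n.+1 * #|T|%:R ^+ n.+3
    <= (\sum_u walks E n.+3 u u)%:R.
Proof.
move=> e0 e1 g0 T0 PE reg big; set kappa := 2 * eps * (eps * gam).
have N0 : 0 < #|T|%:R :> R by rewrite ltr0n.
have bigS i : (i <= n.+3)%N -> gam * #|T|%:R <= #|P i|%:R.
  by rewrite leq_eqVlt => /predU1P[->|/big//]; rewrite PE big.
have P0 i : (i <= n.+3)%N -> (0 < #|P i|)%N.
  by move=> /bigS; rewrite -(ltr0n R); apply: lt_le_trans; rewrite mulr_gt0.
have k0 : 0 < kappa by rewrite !mulr_gt0.
have kN0 j : 0 <= (kappa * #|T|%:R) ^+ j.
  by rewrite exprn_ge0 // mulr_ge0 // ltW.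
pose reach u j := [set v in P j.+1 | (kappa * #|T|%:R) ^+ j <= (walks E j.+1 u v)%:R].
have reachP u j : #|P j.+1| = (#|reach u j| + #|P j.+1 :\: reach u j|)%N.
  rewrite -(cardsID (reach u j) (P j.+1)); congr (#|(_ : {set T})| + _)%N.
  by apply/setIidPr/subsetP => v; rewrite inE => /andP[].
have walks_reach u j y : (kappa * #|T|%:R) ^+ j * (\sum_(x in reach u j) E j.+1 x y)%N%:R
    <= (walks E j.+2 u y)%:R.
  rewrite [leRHS]/= !natr_sum mulr_sumr [leRHS](bigID (mem (reach u j))) /=.
  rewrite ler_wpDr ?sumr_ge0 // ler_sum // => w; rewrite inE => /andP[_ ww].
  by rewrite natrM ler_wpM2r.
(* Almost all of the next class is reached, not just a proportion of it. *)
have reach_step u j : (j.+2 < n.+4)%N -> eps * #|P j.+1|%:R <= #|reach u j|%:R ->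
    #|P j.+2 :\: reach u j.+1|%:R < eps * #|P j.+2|%:R.
  move=> jn cR.
  have sR : reach u j \subset P j.+1 by apply/subsetP => v; rewrite inE => /andP[].
  apply: le_lt_trans (few_atypical e0 (reg j.+1 jn) (P0 j.+2 jn) sR cR).
  rewrite ler_nat; apply/subset_leq_card/subsetP => y.
  rewrite !inE => /andP[+ yP]; rewrite yP /=; apply: contraNT.
  rewrite -leNgt => deg.
  have : (kappa * #|T|%:R) ^+ j.+1 <= (kappa * #|T|%:R) ^+ j * (2 * eps * #|reach u j|%:R).
    rewrite exprSr ler_wpM2l //.
    rewrite /kappa -!mulrA !ler_pM2l //.
    by apply: le_trans cR; rewrite ler_pM2l // bigS // ltnW.
  move=> /le_trans; apply; apply: le_trans (walks_reach u j y).
  by rewrite ler_wpM2l.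
have deg_out : #|[set u in P 0%N | (\sum_(x in P 1%N) E 0%N u x)%N%:R < 2 * eps * #|P 1%N|%:R]|%:R
    < eps * #|P 0%N|%:R.
  apply: (few_atypical e0 (lower_regular_swap (reg 0%N _))) => //; first exact: P0.
  by rewrite ler_piMl ?ler0n //; lra.
have deg_in : #|[set u in P 0%N | (\sum_(x in P n.+2) E n.+2 x u)%N%:R < 2 * eps * #|P n.+2|%:R]|%:R
    < eps * #|P 0%N|%:R.
  rewrite -PE; apply: (few_atypical e0 (reg n.+2 _)) => //; first exact: P0.
  by rewrite ler_piMl ?ler0n //; lra.
set Dout := finset _ in deg_out; set Din := finset _ in deg_in.
pose typ := P 0%N :\: (Dout :|: Din).
(* Fewer than 2 * eps <= 1 / 2 of the vertices of P 0 are excluded. *)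
have card_typ : gam / 2 * #|T|%:R <= #|typ|%:R.
  have : (#|P 0%N| <= #|typ| + (#|Dout| + #|Din|))%N.
    rewrite -(cardsID (Dout :|: Din) (P 0%N)) addnC leq_add2l.
    apply: leq_trans (subset_leq_card (subsetIr _ _)) _.
    exact: leq_card_setU.
  rewrite -(ler_nat R) !natrD.
  have : eps * #|P 0%N|%:R <= 4^-1 * #|P 0%N|%:R by rewrite ler_wpM2r.
  by move: deg_out deg_in (big 0%N isT); lra.
have walks_typ u : u \in typ ->
    eps * gam * kappa ^+ n.+1 * #|T|%:R ^+ n.+2 <= (walks E n.+3 u u)%:R.
  rewrite !inE negb_or => /andP[/andP[+ +] uP]; rewrite uP /= -!leNgt => out_u in_u.
  have reach_big j : (j.+1 < n.+3)%N -> eps * #|P j.+1|%:R <= #|reach u j|%:R.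
    elim: j => [_|j IH jn]; last first.
      move: (reach_step u j (leqW jn) (IH (ltnW jn))) (reachP u j.+1) => + /(congr1 (GRing.natmul (1 : R))).
      rewrite natrD.
      have : eps * #|P j.+2|%:R <= 4^-1 * #|P j.+2|%:R by rewrite ler_wpM2r.
      have : 0 <= #|P j.+2|%:R :> R by [].
      by lra.
    apply: (@le_trans _ _ (2 * eps * #|P 1%N|%:R)).
      by rewrite -mulrA ler_peMl ?mulr_ge0 ?(ltW e0) ?ler1n.
    apply: le_trans out_u _; rewrite ler_nat -sum1_card.
    rewrite big_mkcond [leqRHS]big_mkcond; apply: leq_sum => x _.
    rewrite inE expr0 ler1n; case: (x \in P 1%N) => //=.
    rewrite (bigD1 u) //= eqxx mul1n.
    by case: (E 0%N u x).
  have := reach_step u n (leqnSn _) (reach_big n (leqnSn _)).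
  set Q := reach u n.+1 => miss.
  apply: le_trans (walks_reach u n.+1 u); rewrite (exprMn _ kappa).
  have inQ : eps * (gam * #|T|%:R) <= (\sum_(x in Q) E n.+2 x u)%N%:R.
    apply: (@le_trans _ _ (eps * #|P n.+2|%:R)).
      by rewrite ler_wpM2l ?(ltW e0) // bigS // ltnW.
    have : (\sum_(x in P n.+2) E n.+2 x u <= \sum_(x in Q) E n.+2 x u + #|P n.+2 :\: Q|)%N.
      rewrite -sum1_card big_mkcond [X in (_ <= X + _)%N]big_mkcond.
      rewrite [X in (_ <= _ + X)%N]big_mkcond -big_split /=.
      apply: leq_sum => x _; rewrite in_setD.
      by case: (x \in Q); case: (x \in P _); case: (E _ x u).
    by rewrite -(ler_nat R) natrD; move: in_u miss; lra.
  rewrite [leLHS](_ : _ = kappa ^+ n.+1 * #|T|%:R ^+ n.+1 * (eps * (gam * #|T|%:R))).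
    by rewrite -exprMn ler_wpM2l.
  by rewrite (exprS _ n.+1); ring.
apply: (@le_trans _ _ (\sum_(u in typ) eps * gam * kappa ^+ n.+1 * #|T|%:R ^+ n.+2)).
  rewrite sumr_const -[leRHS]mulr_natl.
  rewrite [leLHS](_ : _ = gam / 2 * #|T|%:R * (eps * gam * kappa ^+ n.+1 * #|T|%:R ^+ n.+2)).
    rewrite ler_wpM2r //; apply: mulr_ge0 (exprn_ge0 _ (ltW N0)).
    exact: mulr_ge0 (mulr_ge0 (ltW e0) (ltW g0)) (exprn_ge0 _ (ltW k0)).
  by rewrite (exprS _ n.+2); ring.
rewrite natr_sum [leRHS](bigID (mem typ)) /= ler_wpDr ?sumr_ge0 //.
by apply: ler_sum.
Qed.

End ClosedWalks.

(** * Removing closed walks *)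

(** There are at most [#|K|] small classes. *)
Lemma card_small_parts (T K : finType) (c : T -> K) (t : R) : 0 <= t ->
  #|[pred x | #|part c (c x)|%:R < t]|%:R <= #|K|%:R * t.
Proof.
move=> t0; rewrite -sum1_card natr_sum (partition_big c (fun a => #|part c a|%:R < t)) //=.
apply: (@le_trans _ _ (\sum_(a | #|part c a|%:R < t) t)); last first.
  by rewrite big_mkcond mulr_natl -sumr_const ler_sum // => a _; case: ifP.
apply: ler_sum => a at_; rewrite (eq_bigl (mem (part c a))); last first.
  by move=> x; rewrite !inE; case: eqP => [->|]; rewrite ?at_ ?andbF.
by rewrite -natr_sum sum1_card ltW.
Qed.

Lemma card_sparse_edges (T K : finType) (c : T -> K) (E : rel T) (eps : R) :
  0 <= eps ->
  \sum_(s : T * T) (E s.1 s.2 &&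
     ~~ dense eps E (part c (c s.1)) (part c (c s.2)))%:R
    <= 4 * eps * #|T|%:R ^+ 2.
Proof.
move=> e0.
rewrite -natrX -mulnn -card_prod mulr_natr -sumr_const.
rewrite (partition_big (pair_color c) xpredT) // [leRHS](partition_big (pair_color c) xpredT) //.
apply: ler_sum => -[a b] _ /=.
have [dn|ndn] := boolP (dense eps E (part c a) (part c b)).
  rewrite big1 ?sumr_ge0 // => [s _|s /eqP[-> ->]]; first by rewrite mulr_ge0.
  by rewrite dn andbF.
rewrite !(eq_bigl _ _ (pair_colorE c (a, b))) /=.
apply: (@le_trans _ _ (edges E (part c a) (part c b))%:R).
  by rewrite -sum_edges ler_sum // => s _; case: (E _ _); rewrite ?lern1 ?leq_b1.
move: ndn; rewrite /dense -ltNge => /ltW /le_trans; apply.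
by rewrite sumr_const card_rect mulr_natr.
Qed.

(** The set [D] is made of the pairs in bad pairs of classes, the edges in
sparse pairs of classes, and the pairs with an end in a small class. A closed
walk that avoids [D] runs through classes to which
[closed_walks_lower_bound] applies, so [delta] can be the constant given by
that lemma. *)
Theorem closed_walk_removal (n : nat) (eps : R) : 0 < eps ->
  exists2 delta : R, 0 < delta &
  forall (T : finType) (E : nat -> rel T), (0 < #|T|)%N ->
  (\sum_u walks E n.+3 u u)%:R < delta * #|T|%:R ^+ n.+3 ->
  exists2 D : {set 'I_n.+3 * (T * T)}, #|D|%:R <= eps * #|T|%:R ^+ 2 &
  forall v : nat -> T, v n.+3 = v 0%N ->
    (forall i, (i < n.+3)%N -> E i (v i) (v i.+1)) ->
    exists i : 'I_n.+3, (i, (v i, v i.+1)) \in D.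
Proof.
move=> e0; have [m mE] : exists m : R, m = n.+3%:R by exists n.+3%:R.
have m0 : 0 < m by rewrite mE ltr0n.
pose r := Num.min 4^-1 (eps / (16 * m)).
have r0 : 0 < r by rewrite lt_min invr_gt0 ltr0n divr_gt0 // mulr_gt0.
have r4 : r <= 4^-1 by rewrite ge_min lexx.
(* The budget: eps / 4 each for bad pairs, sparse pairs and small classes. *)
have rm : 4 * r * m <= eps / 4.
  have : r <= eps / (16 * m) by rewrite ge_min lexx orbT.
  rewrite ler_pdivlMr ?mulr_gt0 //; lra.
have [M MP] := @regularity r (eps / 4) 'I_n.+3 r0 (divr_gt0 e0 (ltr0n _ 4)).
(* At most M classes are small, so they cover at most eps / (8 m) of the vertices;
   each of the m relations pays for both ends of an edge. *)
pose gam := eps / (8 * m) / M.+1%:R.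
have g0 : 0 < gam by rewrite !divr_gt0 ?mulr_gt0.
exists (gam / 2 * (r * gam) * (2 * r * (r * gam)) ^+ n.+1).
  have rg0 := mulr_gt0 r0 g0.
  by apply: mulr_gt0 (mulr_gt0 (divr_gt0 g0 _) rg0) (exprn_gt0 _ (mulr_gt0 (mulr_gt0 _ r0) rg0)).
move=> T E T0 few.
have N0 : 0 < #|T|%:R :> R by rewrite ltr0n.
have [K [c [cK reg]]] := MP T (fun i : 'I_n.+3 => E i) T0.
pose B (i : 'I_n.+3) (s : T * T) := bad r (E i) (part c (c s.1)) (part c (c s.2)).
pose V (i : 'I_n.+3) (s : T * T) :=
  E i s.1 s.2 && ~~ dense r (E i) (part c (c s.1)) (part c (c s.2)).
pose small x := #|part c (c x)|%:R < gam * #|T|%:R.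
exists [set t | [|| B t.1 t.2, V t.1 t.2, small t.2.1 | small t.2.2]].
  rewrite -sum1dep_card natr_sum big_mkcond /=.
  rewrite -(pair_bigA _ (fun i s => if [|| B i s, V i s, small s.1 | small s.2] then 1 else 0 : R)) /=.
  have card_small : #|[pred x | small x]|%:R <= eps / (8 * m) * #|T|%:R.
    apply: le_trans (card_small_parts c _) _; first by rewrite ltW // mulr_gt0.
    rewrite mulrA ler_wpM2r // /gam mulrCA ler_piMr //.
      by rewrite ltW // divr_gt0 // mulr_gt0.
    by rewrite ler_pdivrMr ?ltr0n // mul1r ler_nat leqW.
  have sumE (U : finType) (b : pred U) : \sum_x (b x)%:R = #|[pred x | b x]|%:R :> R.
    rewrite -sum1_card natr_sum [RHS]big_mkcond.
    by apply: eq_bigr => x _; rewrite inE; case: (b x).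
  have sum_small1 : \sum_(s : T * T) (small s.1)%:R <= eps / (8 * m) * #|T|%:R ^+ 2 :> R.
    rewrite -(pair_bigA _ (fun x _ => (small x)%:R)) /=.
    under eq_bigr do rewrite sumr_const.
    by rewrite sumrMnl sumE -[leLHS]mulr_natl expr2 mulrA [leRHS]mulrC ler_wpM2l.
  have sum_small2 : \sum_(s : T * T) (small s.2)%:R <= eps / (8 * m) * #|T|%:R ^+ 2 :> R.
    rewrite -(pair_bigA _ (fun _ y => (small y)%:R)) /= sumr_const sumE.
    by rewrite -[leLHS]mulr_natl expr2 mulrA [leRHS]mulrC ler_wpM2l.
  apply: (@le_trans _ _ (\sum_(i : 'I_n.+3) (#|[pred s | B i s]|%:R +
     (4 * r + eps / (4 * m)) * #|T|%:R ^+ 2))).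
    apply: ler_sum => i _.
    apply: (@le_trans _ _ (\sum_s ((B i s)%:R + ((V i s)%:R + ((small s.1)%:R + (small s.2)%:R))))).
      apply: ler_sum => s _.
      by case: (B i s); case: (V i s); case: (small _); case: (small _) => /=; lra.
    rewrite !big_split /= sumE.
    rewrite lerD2l; have := card_sparse_edges c (E i) (ltW r0).
    rewrite (_ : eps / (4 * m) = eps / (8 * m) + eps / (8 * m)); last first.
      by field; rewrite gt_eqF.
    move: sum_small1 sum_small2; lra.
  rewrite big_split /= -natr_sum sumr_const card_ord -[X in _ + X <= _]mulr_natl -mE.
  have -> : m * ((4 * r + eps / (4 * m)) * #|T|%:R ^+ 2)
      = (4 * r * m + eps / 4) * #|T|%:R ^+ 2 by field; rewrite gt_eqF.
  have : (4 * r * m + eps / 4) * #|T|%:R ^+ 2 <= (eps / 4 + eps / 4) * #|T|%:R ^+ 2.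
    by rewrite ler_wpM2r ?exprn_ge0 // lerD2r.
  have : 0 <= eps * #|T|%:R ^+ 2 by rewrite mulr_ge0 ?exprn_ge0 // ltW.
  by move: reg; rewrite /regular_coloring -/B; lra.
move=> v vE walk.
have [//|noD] := boolP [exists i : 'I_n.+3, (i, (v i, v i.+1)) \in
  [set t | [|| B t.1 t.2, V t.1 t.2, small t.2.1 | small t.2.2]]].
  by move/existsP.
have good (i : 'I_n.+3) : [&& lower_regular r (E i) (part c (c (v i))) (part c (c (v i.+1)))
    & gam * #|T|%:R <= #|part c (c (v i))|%:R].
  move: noD; rewrite negb_exists => /forallP/(_ i); rewrite !inE /= !negb_or.
  rewrite /B /V /= (walk i (ltn_ord i)) /= negbK /bad => /and4P[reg_i dn big_i _].
  by move: reg_i big_i; rewrite dn /= negbK /small -leNgt => -> ->.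
move: few; rewrite ltNge => /negP[].
apply: (closed_walks_lower_bound (P := fun i => part c (c (v i)))) => //.
- by rewrite vE.
- by move=> i im; have /andP[] := good (Ordinal im).
- by move=> i im; have /andP[] := good (Ordinal im).
Qed.
End Regularity.
(** * Products in groups as walks in Cayley graphs *)

Section Groups.
Variable R : archiRealFieldType.
Import GroupScope.
Local Open Scope ring_scope.

(** A walk from [u] in the Cayley graph is determined by the labels
[x_i] of its edges, whose product is [u^-1 v]. *)
Lemma walks_le_solutions (G : finGroupType) (A : nat -> {set G}) j (u v : G) :
  (walks (fun i x y => (x^-1 * y)%g \in A i) j u v
    <= #|solutions (fun i : 'I_j => A i) (u^-1 * v)%g|)%N.
Proof.
elim: j v => [|j IH] v /=.
  case: eqP => //= <-; apply/card_gt0P; exists [ffun=> 1%g].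
  rewrite inE big_ord0 mulVg eqxx andbT.
  by apply/forallP => -[].
set S := solutions _ _; pose w (x : {ffun 'I_j.+1 -> G}) := (v * (x ord_max)^-1)%g.
rewrite -[leqRHS]sum1_card (partition_big w xpredT) //=; apply: leq_sum => y _.
case: (boolP ((y^-1 * v)%g \in A j)) => [Ay|]; last by rewrite muln0.
rewrite muln1; apply: leq_trans (IH y) _.
pose ext (f : {ffun 'I_j -> G}) : {ffun 'I_j.+1 -> G} :=
  [ffun i => oapp f (y^-1 * v)%g (unlift ord_max i)].
have extM f : ext f ord_max = (y^-1 * v)%g by rewrite ffunE unlift_none.
have extL f k : ext f (lift ord_max k) = f k by rewrite ffunE liftK.
have ext_inj : injective ext.
  by move=> f1 f2 /ffunP e; apply/ffunP => k; have := e (lift ord_max k); rewrite !extL.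
rewrite -(card_imset _ ext_inj) -sum1_card [X in (X <= _)%N]sum1_card sum1dep_card.
apply/subset_leq_card/subsetP => x /imsetP[f + ->{x}]; rewrite !inE => /andP[/forallP fA /eqP pf].
rewrite /w extM invMg invgK mulKVg eqxx andbT; apply/andP; split.
  apply/forallP => i; case: (unliftP ord_max i) => [k|] ->; last by rewrite extM.
  by rewrite extL lift_max.
rewrite big_ord_recr /= extM (eq_bigr f) ?pf.
  by rewrite -mulgA mulKVg.
move=> k _; rewrite -(extL f); congr (ext f _); apply: val_inj.
by rewrite /= /bump leqNgt ltn_ord.
Qed.

(** Multiplying the last entry by [h] moves the right-hand side from [g]
to [g h]. The sets [A] and [B] are related by a membership condition, not by
cosets, so that the lemma applies to images and preimages under the shift. *)
Lemma solutions_shift (G : finGroupType) n (A B : 'I_n.+1 -> {set G}) (g h : G)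
    (s := fun i : 'I_n.+1 => if i == ord_max then h else 1%g)
    (x : {ffun 'I_n.+1 -> G}) :
  (forall i y, ((y * s i)%g \in B i) = (y \in A i)) ->
  ([ffun i => x i * s i]%g \in solutions B (g * h)%g) = (x \in solutions A g).
Proof.
move=> AB; rewrite !inE; congr (_ && _).
  by apply: eq_forallb => i; rewrite ffunE AB.
rewrite !big_ord_recr /= ffunE {2}/s eqxx mulgA (inj_eq (mulIg h)).
congr (_ * _ == _)%g; apply: eq_bigr => i _; rewrite ffunE /s.
by case: eqP => [/(congr1 val)/= iM|]; rewrite ?mulg1 //; have := ltn_ord i; rewrite iM ltnn.
Qed.

Definition removable (G : finGroupType) (m : nat) (A : 'I_m -> {set G}) (g : G)
    (eps : R) : Prop :=
  exists A' : 'I_m -> {set G},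
    [/\ forall i, A' i \subset A i,
        forall i, #|A i :\: A' i|%:R <= eps * #|G|%:R
      & solutions A' g = finset.set0].

(** An element of [A i] is discarded when at least [#|G| / m] of the [#|G|]
edges with that label are in the removed set [D]. For a solution [x] that
survives, the walks from all [#|G|] vertices with labels [x] are closed and
meet [D], and at each step they use pairwise distinct edges. *)
Lemma removal_homogeneous (n : nat) (eps : R) : 0 < eps ->
  exists2 delta : R, 0 < delta &
  forall (G : finGroupType) (A : 'I_n.+3 -> {set G}),
  #|solutions A 1%g|%:R < delta * #|G|%:R ^+ n.+2 ->
  removable A 1%g eps.
Proof.
move=> e0; have m0 : 0 < n.+3%:R :> R by rewrite ltr0n.
have [delta d0 removal] := closed_walk_removal n (divr_gt0 e0 m0).
exists delta => // G A few.
have G0 : (0 < #|G|)%N by apply/card_gt0P; exists 1%g.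
have N0 : 0 < #|G|%:R :> R by rewrite ltr0n.
pose An i := oapp A finset.set0 (insub i).
have AnE (i : 'I_n.+3) : An i = A i by rewrite /An valK.
pose E i (x y : G) := (x^-1 * y)%g \in An i.
have [//||D cardD hitD] := removal G E.
  have -> : delta * #|G|%:R ^+ n.+3 = #|G|%:R * (delta * #|G|%:R ^+ n.+2).
    by rewrite (exprS _ n.+2); ring.
  apply: le_lt_trans (_ : #|G|%:R * #|solutions A 1%g|%:R < _); last by rewrite ltr_pM2l.
  rewrite -natrM ler_nat -sum_nat_const leq_sum // => u _.
  apply: leq_trans (walks_le_solutions _ _ _ _) _; rewrite mulVg.
  apply/subset_leq_card/subsetP => x; rewrite !inE => /andP[/forallP xA ->].
  by rewrite andbT; apply/forallP => i; rewrite -AnE.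
(* The number of removed edges of kind i with label x. *)
pose F i x := #|[set u : G | (i, (u, u * x)%g) \in D]|.
exists (fun i => [set x in A i | (n.+3 * F i x < #|G|)%N]); split=> [i|i|].
- by apply/subsetP => x; rewrite inE => /andP[].
- set X := _ :\: _.
  have sumF : (\sum_x F i x <= #|D|)%N.
    rewrite /F; under eq_bigr do rewrite -sum1dep_card big_mkcond /=.
    rewrite pair_bigA -big_mkcond sum1dep_card /=.
    have inj_f : injective (fun q : G * G => (i, (q.2, q.2 * q.1)%g)).
      by move=> [x u] [y w] /= [-> /mulgI ->].
    rewrite -(card_imset _ inj_f); apply/subset_leq_card/subsetP => q /imsetP[r + ->].
    by rewrite inE.
  have : (#|X| * #|G| <= n.+3 * #|D|)%N.
    apply: leq_trans (_ : n.+3 * (\sum_x F i x) <= _)%N; last by rewrite leq_mul2l sumF.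
    rewrite big_distrr /= -sum_nat_const [X in (_ <= X)%N](bigID (mem X)) /= -[X in (X <= _)%N]addn0.
    rewrite leq_add // leq_sum // => x; rewrite !inE.
    by case: (x \in A i); rewrite ?andbF //= andbT -leqNgt.
  rewrite -(ler_nat R) !natrM => le1.
  rewrite -(ler_pM2r N0); apply: le_trans le1 _.
  rewrite -mulrA -expr2 mulrC -ler_pdivlMr // mulrAC.
  by apply: le_trans cardD _; rewrite mulrAC.
apply/setP => x; rewrite in_set0; apply/negP; rewrite inE => /andP[/forallP xA' /eqP px].
pose xn i := oapp x 1%g (insub i).
have xnE (i : 'I_n.+3) : xn i = x i by rewrite /xn valK.
pose p k := (\prod_(0 <= i < k) xn i)%g.
have pS u k : (u * p k.+1 = u * p k * xn k)%g by rewrite /p big_nat_recr //= mulgA.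
have hit u : (0 < \sum_(i < n.+3) ((i, (u * p i, u * p i * x i)%g) \in D))%N.
  have [|i im|i Di] := hitD (fun k => u * p k)%g.
  - rewrite /p big_mkord big_nil (eq_bigr x) ?px // => i _; exact: xnE.
  - rewrite /E pS mulKg (xnE (Ordinal im)) (AnE (Ordinal im)).
    by have := xA' (Ordinal im); rewrite inE => /andP[].
  - rewrite (bigD1 i) //=; move: Di; rewrite pS xnE => ->.
    by [].
have : (#|G| <= \sum_(i < n.+3) F i (x i))%N.
  rewrite -[X in (X <= _)%N]sum1_card.
  apply: leq_trans (_ : \sum_u \sum_(i < n.+3) ((i, (u * p i, u * p i * x i)%g) \in D) <= _)%N.
    by apply: leq_sum => u _; exact: hit.
  rewrite exchange_big /=; apply: leq_sum => i _.
  rewrite -(reindex_inj (mulIg (p i)) (P := xpredT) (F := fun u => ((i, (u, u * x i)%g) \in D) : nat)) /=.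
  by rewrite /F -sum1dep_card [X in (_ <= X)%N]big_mkcond /= leq_sum // => u _; case: (_ \in _).
apply/negP; rewrite -ltnNge -(ltn_pmul2l (m := n.+3)) // big_distrr /=.
have few_i (i : 'I_n.+3) : (n.+3 * F i (x i) < #|G|)%N.
  by have := xA' i; rewrite inE => /andP[].
rewrite big_ord_recl /= [leqRHS]mulSn -addSn leq_add ?few_i //.
rewrite -[X in (_ <= X * _)%N]card_ord -sum_nat_const.
by apply: leq_sum => i _; exact: ltnW.
Qed.

(** Discard every element that occurs in a solution. *)
Lemma removable_few_solutions (G : finGroupType) (m : nat) (A : 'I_m.+1 -> {set G})
    (g : G) (eps : R) :
  #|solutions A g|%:R <= eps * #|G|%:R -> removable A g eps.
Proof.
move=> few; exists (fun i => A i :\: [set (x : {ffun _ -> _}) i | x in solutions A g]).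
split=> [i|i|]; first exact: subsetDl.
  apply: le_trans few; rewrite setDDr setDv set0U ler_nat.
  exact: leq_trans (subset_leq_card (subsetIr _ _)) (leq_imset_card _ _).
apply/setP => x; rewrite in_set0; apply/negP => xA'.
have xA : x \in solutions A g.
  move: xA'; rewrite !inE => /andP[/forallP xA' ->]; rewrite andbT.
  by apply/forallP => i; have := xA' i; rewrite inE => /andP[].
move: xA'; rewrite inE => /andP[/forallP/(_ ord0)]; rewrite inE => /andP[/negP[]].
by apply/imsetP; exists x.
Qed.

Lemma removable1 (G : finGroupType) (m : nat) (A : 'I_m -> {set G}) (g : G) :
  (0 < m)%N -> removable A g 1.
Proof.
move=> m0; exists (fun=> set0); split=> [i|i|].
- exact: sub0set.
- by rewrite mul1r ler_nat max_card.
apply/setP => x; rewrite !inE; apply/negP => /andP[/forallP/(_ (Ordinal m0))].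
by rewrite inE.
Qed.

(** For [m = 2] the hypothesis bounds the number of solutions by [delta * #|G|],
so [delta = eps] will do. *)
Theorem group_removal (m : nat) (eps : R) : (2 <= m)%N -> 0 < eps ->
  exists2 delta : R, 0 < delta &
  forall (G : finGroupType) (A : 'I_m -> {set G}) (g : G),
  #|solutions A g|%:R < delta * #|G|%:R ^+ m.-1 -> removable A g eps.
Proof.
case: m => [|[|[|n]]] // _ e0.
  by exists eps => // G A g; rewrite expr1 => /ltW; apply: removable_few_solutions.
have [delta d0 removal] := removal_homogeneous n e0.
exists delta => // G A g few.
pose s (i : 'I_n.+3) : G := if i == ord_max then (g^-1)%g else 1%g.
pose shift (x : {ffun 'I_n.+3 -> G}) : {ffun 'I_n.+3 -> G} := [ffun i => x i * s i]%g.
have shift_inj : injective shift.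
  by move=> x y /ffunP e; apply/ffunP => i; have := e i; rewrite !ffunE => /mulIg.
pose As i := A i :* s i; have AsP i y : ((y * s i)%g \in As i) = (y \in A i).
  by rewrite mem_rcoset mulgK.
have [|B [subB cardB noB]] := removal G As.
  rewrite -(card_preimset _ shift_inj) (_ : _ @^-1: _ = solutions A g) //.
  by apply/setP => x; rewrite inE -(mulgV g) (solutions_shift _ _ AsP).
exists (fun i => [set y | (y * s i)%g \in B i]); split=> [i|i|].
- by apply/subsetP => y; rewrite inE => /(subsetP (subB i)); rewrite AsP.
- apply: le_trans (cardB i); rewrite ler_nat -(card_imset _ (mulIg (s i))).
  apply/subset_leq_card/subsetP => _ /imsetP[y + ->].
  by rewrite !inE AsP.
apply/setP => x; rewrite in_set0 -(@solutions_shift _ _ _ B g g^-1%g); last first.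
  by move=> i y; rewrite inE.
by rewrite mulgV noB in_set0.
Qed.
End Groups.
(** * The rate as a function of delta *)

From mathcomp Require Import all_classical all_reals all_analysis.
Import numFieldNormedType.Exports.
Local Open Scope classical_set_scope.

Theorem theorem2 (R : realType) (m : nat) (hm : (2 <= m)%N) :
  exists delta' : R -> R,
    (delta' delta @[delta --> 0^'+] --> (0 : R)) /\
    forall delta : R, 0 < delta ->
    forall (G : finGroupType) (A : 'I_m -> {set G}) (g : G),
      #|solutions A g|%:R < delta * #|G|%:R ^+ m.-1 ->
      exists A' : 'I_m -> {set G},
        [/\ forall i, A' i \subset A i,
            forall i, #|A i :\: A' i|%:R <= delta' delta * #|G|%:R
          & solutions A' g = finset.set0].
Proof.
pose good (delta : R) : set R := [set e | 0 <= e /\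
  forall (G : finGroupType) (A : 'I_m -> {set G}) (g : G),
    #|solutions A g|%:R < delta * #|G|%:R ^+ m.-1 -> removable A g e].
have good_lb delta : has_lbound (good delta) by exists 0 => e [].
have good_inf delta : has_inf (good delta).
  by split=> //; exists 1; split=> // G A g _; apply: removable1; apply: ltnW.
exists (fun delta => inf (good delta) + delta); split; last first.
  move=> delta d0 G A g few.
  have [e [e0 eP] lte] := inf_adherent d0 (good_inf delta).
  have [A' [subA cardA noA]] := eP G A g few; exists A'; split=> // i.
  by apply: le_trans (cardA i) _; rewrite ler_wpM2r // ltW.
apply/cvgrPdist_lt => e e0.
have e20 : 0 < e / 2 by rewrite divr_gt0.
have [delta0 d0 removal] := group_removal hm e20.
near=> delta.
have dpos : 0 < delta by near: delta; exact: nbhs_right_gt.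
have d1 : delta < delta0 by near: delta; exact: nbhs_right_lt.
have d2 : delta < e / 2 by near: delta; exact: nbhs_right_lt.
have inf_ge0 : 0 <= inf (good delta).
  by apply: lb_le_inf; [exact: (good_inf delta).1|move=> x []].
have inf_le : inf (good delta) <= e / 2.
  apply: ge_inf => //; split=> [|G A g few]; first exact: ltW.
  apply: removal; apply: lt_le_trans few _.
  by rewrite ler_wpM2r ?exprn_ge0 // ltW.
rewrite sub0r normrN ger0_norm; lra.
Unshelve. all: by end_near.
Qed.
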